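(* Let $d\geq 3$ be fixed and let $\mathcal{G}=\{G\}$ be a family of finite simple connected $d$-regular non-bipartite graphs that is asymptotically Ramanujan, i.e. $$\lim_{G\in\mathcal{G},\,|G|\to\infty}\rho_G=\rho_d:=\frac{2\sqrt{d-1}}{d}.$$ Then $\mathcal{G}$ exhibits cutoff. In fact, for any $\alpha\in(0,1)$ and every choice of starting points $X_G^0\in G$ $(G\in\mathcal{G})$, $$\lim_{G\in\mathcal{G},\,|G|\to\infty}\frac{T^{\mathrm{mix}}_G(\alpha)}{\log |G|}=\frac{d}{(d-2)\log(d-1)}.$$
   Context: A graph $G$ is identified with its vertex set, and $|G|$ is the number of vertices. For a finite simple connected $d$-regular non-bipartite graph $G$, let $P$ be the normalized adjacency matrix on $G$: $P(x,y)=\frac1d$ if $x$ and $y$ are adjacent and $P(x,y)=0$ otherwise. Its eigenvalues are $1=\lambda_1>\lambda_2\geq\cdots\geq\lambda_{|G|}>-1$. The reduced spectral radius is $\rho_G:=\max\{\lambda_2,-\lambda_{|G|}\}<1$, the operator norm of $P$ restricted to the orthogonal complement of the constant vectors in $\ell_2 G$. For a starting point $X^0_G\in G$, let $(X^t)_{t\in\mathbb{N}}$ be the simple random walk on $G$ started at $X_G^0$, let $\mu_G^t:=P^t(\,\cdot\,,X_G^0)$ be the distribution of $X^t$ ($t=0,1,2,\dots$), and let $\pi$ be the uniform probability distribution on $G$. The total variation norm is $\|\nu-\eta\|_{\mathrm{TV}}=\max_{A\subset G}|\nu(A)-\eta(A)|=\frac12\sum_{x\in G}|\nu(x)-\eta(x)|$.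 For $\alpha\in(0,1)$ the total variation mixing time (which depends on the starting point) is $T_G^{\mathrm{mix}}(\alpha):=\min\{t\in\mathbb{N}:\|\mu_G^t-\pi\|_{\mathrm{TV}}<\alpha\}$. The family $\mathcal{G}$ is said to exhibit cutoff if $$\lim_{G\in\mathcal{G},\,|G|\to\infty}\frac{T_G^{\mathrm{mix}}(\alpha)}{T_G^{\mathrm{mix}}(\alpha')}=1$$ for every $\alpha,\alpha'\in(0,1)$ and every choice of the starting points $X_G^0\in G$ ($G\in\mathcal{G}$). A limit $\lim_{G\in\mathcal{G},\,|G|\to\infty}a_G=a$ means: for every $\eta>0$ there is $N$ such that $|a_G-a|<\eta$ for all $G\in\mathcal{G}$ with $|G|>N$. *)

(* Defs.v *)
From mathcomp Require Import all_boot all_order all_algebra.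
From mathcomp Require Import complex.
From mathcomp Require Import boolp classical_sets reals exp.

Set Implicit Arguments.
Unset Strict Implicit.
Unset Printing Implicit Defensive.

Import Order.TTheory GRing.Theory Num.Theory.

Local Open Scope ring_scope.

Record sgraph := SGraph {
  svertex :> finType;
  sedge : rel svertex;
  sedge_sym : symmetric sedge;
  sedge_irrefl : irreflexive sedge }.

Definition connected (G : sgraph) :=
  (0 < #|G|)%N /\ forall x y : G, connect (@sedge G) x y.

Definition regular (d : nat) (G : sgraph) :=
  forall x : G, #|[set y | sedge x y]| = d.

Definition bipartite (G : sgraph) :=
  exists A : {set G}, forall x y : G, sedge x y -> (x \in A) != (y \in A).

Section Spectrum.
Variable R : realType.

Definition is_spectrum n (A : 'M[R]_n) (s : seq R) :=
  sorted >=%R s /\ char_poly A = \prod_(a <- s) ('X - a%:P).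

(* The nonincreasing list of the eigenvalues of A, with multiplicity. The
   default [::] is only used if char_poly A does not split over R; by
   spectrumP this never happens for symmetric A. *)
Definition spectrum n (A : 'M[R]_n) : seq R := xget [::] (is_spectrum A).

Lemma is_spectrum_ex n (A : 'M[R]_n) : A^T = A -> exists s, is_spectrum A s.
Proof.
move=> symA.
pose f : {rmorphism R -> R[i]} := real_complex R.
pose B := map_mx f A.
have herm : B \is hermsymmx.
  apply: realsym_hermsym.
    apply/is_hermitianmxP.
    by rewrite expr0 scale1r map_mx_id // /B map_trmx symA.
  by apply/mxOverP => i j; rewrite mxE /f /= complex_real.
have real := hermitian_spectral_diag_real herm.
have /orthomx_spectralP eB := hermitian_normalmx herm.
have Pu := spectral_unit B.
move: real eB Pu; set D := spectral_diag B; set P := spectralmx B => real eB Pu.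
pose r := [seq complex.Re (D 0 i) | i : 'I_n].
have ser : char_poly B = \prod_(a <- r) ('X - (f a)%:P).
  pose Q := map_mx (@polyC R[i]) P; pose Q' := map_mx (@polyC R[i]) (invmx P).
  have QQ : Q' *m Q = 1%:M by rewrite -map_mxM mulVmx // map_mx1.
  have -> : char_poly B = \det (Q' *m char_poly_mx (diag_mx D) *m Q).
    rewrite /char_poly /char_poly_mx {1}eB !map_mxM -/Q -/Q' mulmxBr mulmxBl.
    by congr (\det (_ - _)); rewrite scalar_mxC -mulmxA QQ mulmx1.
  rewrite !det_mulmx mulrAC -det_mulmx QQ det1 mul1r.
  rewrite -/(char_poly _) char_poly_trig ?diag_mx_is_trig //.
  rewrite big_map big_enum /=; apply: eq_bigr => i _.
  by rewrite mxE eqxx mulr1n /f /= RRe_real //; apply: (mxOverP real).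
exists (sort >=%R r); split.
  by apply: sort_sorted => x y /=; exact: le_total.
have /(perm_big _) -> : perm_eq (sort >=%R r) r by rewrite perm_sort.
apply: (@map_poly_inj _ _ f).
rewrite map_char_poly -/B ser rmorph_prod /=; apply: eq_bigr => a _.
by rewrite rmorphB /= map_polyX map_polyC.
Qed.

Lemma spectrumP n (A : 'M[R]_n) : A^T = A -> is_spectrum A (spectrum A).
Proof. by move=> /is_spectrum_ex [s hs]; exact: (xgetI _ hs). Qed.

End Spectrum.

Section Walk.
Variables (R : realType) (d : nat) (G : sgraph).

(* Row and column i stand for the vertex enum_val i. *)
Definition adjmx : 'M[R]_#|G| :=
  \matrix_(i, j) if sedge (enum_val i) (enum_val j) then d%:R^-1 else 0.

Lemma adjmx_sym : adjmx^T = adjmx.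
Proof. by apply/matrixP => i j; rewrite !mxE sedge_sym. Qed.

Definition rho : R :=
  let s := spectrum adjmx in Num.max s`_1 (- s`_#|G|.-1).

Definition walk_distr (x0 : G) (t : nat) (x : G) : R :=
  (adjmx ^+ t) (enum_rank x) (enum_rank x0).

Definition uniform_distr (x : G) : R := #|G|%:R^-1.

Definition tv_dist (nu eta : G -> R) : R :=
  \big[Num.max/0]_(A : {set G}) `|\sum_(x in A) nu x - \sum_(x in A) eta x|.

Definition mixed (x0 : G) (alpha : R) (t : nat) : bool :=
  tv_dist (walk_distr x0 t) uniform_distr < alpha.

(* The value 0 is a default for walks that never mix; on a connected
   non-bipartite d-regular graph the minimum exists for every alpha > 0. *)
Definition Tmix (x0 : G) (alpha : R) : nat :=
  if pselect (exists t, mixed x0 alpha t) is left h then ex_minn h else 0%N.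

End Walk.

Section Family.
Variables (R : realType) (I : Type) (G : I -> sgraph).

Definition size_lim (a : I -> R) (l : R) :=
  forall eta : R, 0 < eta ->
    exists N : nat, forall i, (N < #|G i|)%N -> `|a i - l| < eta.

Definition asymptotically_Ramanujan (d : nat) :=
  size_lim (fun i => rho R d (G i)) (2 * Num.sqrt (d%:R - 1) / d%:R).

Definition exhibits_cutoff (d : nat) :=
  forall (alpha alpha' : R) (X : forall i, G i),
    0 < alpha < 1 -> 0 < alpha' < 1 ->
    size_lim
      (fun i => (Tmix d (X i) alpha)%:R / (Tmix d (X i) alpha')%:R) 1.

End Family.

(* Main.v *)
Require Import Defs.
From mathcomp Require Import all_boot all_order all_algebra.
From mathcomp Require Import complex ring lra.
From mathcomp Require Import boolp reals sequences exp.

Set Implicit Arguments.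
Unset Strict Implicit.
Unset Printing Implicit Defensive.

Import Order.TTheory GRing.Theory Num.Theory.

Local Open Scope ring_scope.

(** The walk is read off the universal cover. Lift the simple random walk to
    the d-regular tree: its distance K_t to the root is a birth-death chain on
    the natural numbers, stepping up with probability (d-1)/d and down with
    probability 1/d when it is not at 0, and surely up when it is at 0. Given
    K_t = k the lifted walk is uniform on the sphere
    of radius k. Downstairs, the uniform law on that sphere becomes the law
    nu_k of the endpoint of a uniform nonbacktracking walk of length k from x0,
    so the law of X^t is the mixture of the nu_k with weights P(K_t = k). This
    is walk_distr_radial. The tree stays implicit in the proof: one averaging
    step on G acts on the family nu_k exactly as one step of the chain K
    (avg_nbdistr).

    The chain K_t has speed v = (d-2)/d and E (K_t - v t)^2 <= t
    (radial_mean_sqr_dev). Hence K_t is within o(t) of v t with probability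
    close to 1, and the mixing of X^t is decided by the mixing of nu_k for k
    close to v t. That happens around k = log_(d-1) |G|, which gives the time
    log_(d-1) |G| / v, whatever the threshold alpha.

    - Before: nu_0, ..., nu_K together charge at most d (d-1)^K vertices, a
      vanishing fraction of G when K is (1 - eps) log_(d-1) |G|
      (not_mixed_of_ball).

    - After: the vectors M_k = (d-1)^(k/2) (nu_k - pi) satisfy the Chebyshev
      recurrence M_(k+2) = T M_(k+1) - M_k with T = (d / sqrt(d-1)) P. For
      symmetric T the quadratic quantity
      |M_(k+1)|^2 - <T M_k, M_(k+1)> + |M_k|^2 is conserved, and here it is at
      most 1. On the complement of the constants T has norm at most 2 + eta^2
      as soon as rho_G is close enough to 2 sqrt(d-1) / d, so that
      (|M_(k+1)| - |M_k|)^2 <= 1 + eta^2 |M_k| |M_(k+1)|, which only allows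
      |M_k| <= (k+1) / (1-eta)^k (linear_growth, norm_nbdev_le). By
      Cauchy-Schwarz the total variation distance of nu_k to pi is then at
      most sqrt |G| (k+1) / (sqrt(d-1) (1-eta))^k. For k at least
      (1 + eps) log_(d-1) |G| and eta small enough in terms of eps, this tends
      to 0.

    Both parts of the theorem follow from the resulting window (Tmix_window):
    the mixing time is (1 +- eps) d log |G| / ((d-2) log (d-1)). *)

(** * Contraction by the reduced spectral radius *)

Section ReducedSpectralRadius.
Variables (R : realType) (n : nat).
Implicit Types (A : 'M[R]_n) (s : seq R).
Local Open Scope sesquilinear_scope.

Lemma size_is_spectrum A s : is_spectrum A s -> size s = n.
Proof.
move=> [_ /(congr1 (fun p : {poly R} => size p))].
by rewrite size_char_poly size_prod_XsubC => -[].
Qed.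

Lemma count_large_spectrum A s r : is_spectrum A s ->
  s`_1 <= r -> - r <= s`_n.-1 ->
  (count (fun a => ~~ (- r <= a <= r)%R) s <= 1)%N.
Proof.
move=> As s1 sn; have sz := size_is_spectrum As; case: As => srt _.
case: s srt s1 sn sz => //= a s srt s1 sn sz.
suff -> : count (fun b => ~~ (- r <= b <= r)%R) s = 0%N by rewrite addn0 leq_b1.
apply/eqP; rewrite -leqn0 leqNgt -has_count; apply/hasPn => b bs.
rewrite negbK; have jn : (index b s < size s)%N by rewrite index_mem.
have ge_tr : transitive (>=%R : rel R) by move=> y x z; exact: (@ge_trans _ R).
have mono := @sorted_leq_nth _ _ ge_tr (@lexx _ R) 0 (a :: s) srt.
rewrite -(nth_index 0 bs); apply/andP; split.
  rewrite (le_trans sn) //.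
  have := mono (index b s).+1 n.-1; rewrite !inE /= -sz /=.
  by apply => //; exact: ltnW.
apply: le_trans s1.
have := mono 1%N (index b s).+1; rewrite !inE /=.
by apply => //; case: (s) jn.
Qed.

(** In a unitary eigenbasis of A over the complex numbers, w has nonzero
    coordinates only on eigenvalues equal to l > r, and at most one eigenvalue
    lies outside [-r, r]. So w spans that eigenline, v has no component along
    it, and A contracts every other coordinate of v by r. *)
Lemma sum_sqr_mulmx_le A s l r (w v : 'rV[R]_n) :
    A^T = A -> is_spectrum A s ->
    s`_1 <= r -> - r <= s`_n.-1 -> r < l -> w != 0 -> w *m A = l *: w ->
    v *m w^T = 0 ->
  \sum_i (v *m A) 0 i ^+ 2 <= r ^+ 2 * \sum_i v 0 i ^+ 2.
Proof.
move=> symA As s1 sn rl w0 wA vw.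
pose f : {rmorphism R -> R[i]} := real_complex R.
pose B := map_mx f A.
have herm : B \is hermsymmx.
  apply: realsym_hermsym.
    by apply/is_hermitianmxP; rewrite expr0 scale1r map_mx_id // /B map_trmx symA.
  by apply/mxOverP => i j; rewrite mxE /f /= complex_real.
have /orthomx_spectralP eB := hermitian_normalmx herm.
have Pu := spectral_unitarymx B.
move: eB Pu; set D := spectral_diag B; set P := spectralmx B => eB Pu.
rewrite invmx_unitary // in eB.
have PP : P *m P^t* = 1%:M by apply/unitarymxP.
have PQ : P^t* *m P = 1%:M by rewrite -invmx_unitary // mulVmx // unitarymx_unit.
have charB : char_poly B = \prod_(z <- [seq D 0 i | i : 'I_n]) ('X - z%:P).
  pose Q := map_mx (@polyC R[i]) P; pose Q' := map_mx (@polyC R[i]) (P^t*).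
  have QQ : Q' *m Q = 1%:M by rewrite -map_mxM PQ map_mx1.
  have -> : char_poly B = \det (Q' *m char_poly_mx (diag_mx D) *m Q).
    rewrite /char_poly /char_poly_mx {1}eB !map_mxM -/Q -/Q' mulmxBr mulmxBl.
    by congr (\det (_ - _)); rewrite scalar_mxC -mulmxA QQ mulmx1.
  rewrite !det_mulmx mulrAC -det_mulmx QQ det1 mul1r.
  rewrite -/(char_poly _) char_poly_trig ?diag_mx_is_trig //.
  rewrite big_map big_enum /=; apply: eq_bigr => i _.
  by rewrite mxE eqxx mulr1n.
have permD : perm_eq [seq f a | a <- s] [seq D 0 i | i : 'I_n].
  apply: prod_XsubC_eq.
  rewrite -charB -map_char_poly As.2 rmorph_prod /= big_map.
  apply: eq_bigr => a _.
  by rewrite rmorphB /= map_polyX map_polyC.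
pose large := [pred z : R[i] | ~~ (- f r <= z <= f r)].
have cntD : (#|[pred i : 'I_n | large (D 0%R i)]| <= 1)%N.
  have -> : #|[pred i : 'I_n | large (D 0%R i)]| =
      count large [seq D 0 i | i : 'I_n].
    by rewrite count_map cardE /enum_mem size_filter -enumT (filter_predT (enum _)).
  rewrite -(permP permD) count_map.
  apply: leq_trans (count_large_spectrum As s1 sn).
  by apply/eq_leq/eq_count => a /=; rewrite -rmorphN /= !lecR.
pose a := map_mx f v *m P^t*; pose b := map_mx f w *m P^t*.
have aP : map_mx f v = a *m P by rewrite -mulmxA PQ mulmx1.
have bP : map_mx f w = b *m P by rewrite -mulmxA PQ mulmx1.
have aE : map_mx f v *m P^t* = a by [].
clearbody a b.
(* a and b are the coordinates of v and w in the eigenbasis. *)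
have bD i : b 0 i * D 0 i = f l * b 0 i.
  have : map_mx f w *m B = f l *: map_mx f w.
    by rewrite -map_mxM wA map_mxZ.
  rewrite eB bP => /(congr1 (fun M => M *m P^t*)) /=.
  rewrite !mulmxA -(mulmxA b) PP mulmx1.
  rewrite -scalemxAl -(mulmxA (b *m diag_mx D)) -(mulmxA b P) PP !mulmx1.
  by move=> /rowP/(_ i); rewrite mul_mx_diag !mxE.
have [i0 bi0] : exists i, b 0 i != 0.
  apply/existsP; apply: contra_neqT w0 => /existsPn b0.
  have {}b0 : b = 0.
    by apply/rowP => i; rewrite mxE; apply/eqP; exact: (negbNE (b0 i)).
  by apply/eqP; rewrite -(map_mx_eq0 f) bP b0 mul0mx.
have Di0 : D 0 i0 = f l.
  by apply: (mulfI bi0); rewrite bD mulrC.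
have small i : i != i0 -> - f r <= D 0 i <= f r.
  move=> ii0; apply: contraNT ii0 => Di; apply/eqP.
  have /card_le1_eqP := cntD; apply; rewrite !inE //.
  by rewrite Di0 -rmorphN /= !lecR negb_and -!ltNge rl orbT.
have b0 i : i != i0 -> b 0 i = 0.
  move=> /small/andP[_ Dr]; apply/eqP.
  have /eqP : b 0 i * (D 0 i - f l) = 0 by rewrite mulrBr bD mulrC subrr.
  rewrite mulf_eq0 subr_eq0 => /orP[//|/eqP Dl].
  by move: Dr; rewrite Dl lecR leNgt rl.
have a0 : a 0 i0 = 0.
  have /rowP/(_ 0) : map_mx f v *m (map_mx f w)^t* = 0 :> 'M_1.
    rewrite -[X in _ = X](map_mx0 f) -vw map_mxM /= map_trmx; congr (_ *m _).
    by apply/matrixP => i j; rewrite !mxE conj_Creal // complex_real.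
  rewrite aP bP trmx_mul map_mxM mulmxA -(mulmxA a) PP mulmx1 !mxE.
  rewrite (bigD1 i0) //= big1 => [|i ii0]; last first.
    by rewrite !mxE b0 // rmorph0 mulr0.
  rewrite addr0 !mxE => /eqP; rewrite mulf_eq0 => /orP[/eqP //|].
  by rewrite conjC_eq0 (negPf bi0).
have normP (c : 'rV[R[i]]_n) : \sum_i `|(c *m P) 0 i| ^+ 2 = \sum_i `|c 0 i| ^+ 2.
  have dotE (e : 'rV[R[i]]_n) : \sum_i `|e 0 i| ^+ 2 = (e *m e^t*) 0 0.
    by rewrite !mxE; apply: eq_bigr => i _; rewrite !mxE normCK.
  rewrite !dotE trmx_mul map_mxM mulmxA -(mulmxA c).
  by rewrite PP mulmx1.
have normf (e : 'rV[R]_n) : \sum_i `|(map_mx f e) 0 i| ^+ 2 = f (\sum_i e 0 i ^+ 2).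
  rewrite rmorph_sum; apply: eq_bigr => i _ /=; rewrite !mxE /=.
  by rewrite real_normK ?complex_real // -rmorphXn.
rewrite -lecR.
change (f (\sum_i (v *m A) 0 i ^+ 2) <= f (r ^+ 2 * \sum_i v 0 i ^+ 2)).
rewrite -normf rmorphM rmorphXn -normf map_mxM -/B eB !mulmxA.
rewrite aE normP aP normP mulr_sumr; apply: ler_sum => i _.
rewrite mul_mx_diag mxE normrM exprMn mulrC.
have [->|ii0] := eqVneq i i0; first by rewrite a0 normr0 expr0n /= !mulr0.
apply: ler_wpM2r; first by rewrite exprn_ge0.
have /andP[lo hi] := small _ ii0.
have r0 : 0 <= f r.
  by move: (le_trans lo hi); rewrite -rmorphN /= lecR ler0c => ?; lra.
apply: lerXn2r; rewrite ?nnegrE // real_ler_norml ?lo //.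
by rewrite (ler_real hi) complex_real.
Qed.

End ReducedSpectralRadius.

(** * The averaging operator of a regular graph *)

Section Averaging.
Variables (R : realType) (d : nat) (G : sgraph).
Hypotheses (d_gt0 : (0 < d)%N) (regG : regular d G).
Implicit Types f g : G -> R.

Definition avg f (x : G) : R := (\sum_(y | sedge x y) f y) / d%:R.

Lemma sum_enum_val f : \sum_(i < #|G|) f (enum_val i) = \sum_x f x.
Proof.
rewrite [RHS](reindex (@enum_val G G)) //=.
by apply: onW_bij; exact: enum_val_bij.
Qed.

Lemma card_nbr (x : G) : #|[pred y | sedge x y]| = d.
Proof. by rewrite -(regG x) cardsE. Qed.

Lemma sum_nbr_const (x : G) (c : R) : \sum_(y | sedge x y) c = c * d%:R.
Proof. by rewrite sumr_const card_nbr mulr_natr. Qed.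

Lemma dot_avgC f g : \sum_x avg f x * g x = \sum_x f x * avg g x.
Proof.
under eq_bigr do rewrite /avg mulrAC mulr_suml.
under [RHS]eq_bigr do rewrite /avg mulrA mulr_sumr.
rewrite -!mulr_suml; congr (_ / _).
rewrite (exchange_big_dep xpredT) //=; apply: eq_bigr => x _.
by apply: eq_bigl => y; rewrite sedge_sym.
Qed.

Lemma avg_const c : avg (fun=> c) = fun=> c.
Proof.
apply/funext => x; rewrite /avg sum_nbr_const mulfK //.
by rewrite pnatr_eq0 -lt0n.
Qed.

Lemma walk_distrE (x0 : G) t :
  walk_distr R d x0 t = iter t avg (fun x => (x == x0)%:R).
Proof.
elim: t => [|t IHt]; apply/funext => x.
  by rewrite /walk_distr expr0 mxE (inj_eq enum_rank_inj).
rewrite iterS -IHt /walk_distr exprS mxE /avg.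
rewrite (reindex_onto enum_rank enum_val) /=; last by move=> i _; rewrite enum_valK.
under eq_bigl do rewrite enum_rankK eqxx.
rewrite mulr_suml [RHS]big_mkcond; apply: eq_bigr => y _.
by rewrite mxE !enum_rankK; case: ifP => _; rewrite ?mul0r // mulrC.
Qed.

(** Since rho < 1, the eigenvalue 1 of the constants is separated from the
    rest of the spectrum, so its eigenline is exactly the line of constants. *)
Lemma avg_contraction f : (0 < #|G|)%N -> rho R d G < 1 -> \sum_x f x = 0 ->
  \sum_x avg f x ^+ 2 <= rho R d G ^+ 2 * \sum_x f x ^+ 2.
Proof.
move=> G_gt0 rho_lt1 f0.
pose v : 'rV[R]_#|G| := \row_i f (enum_val i).
have vA i : (v *m adjmx R d G) 0 i = avg f (enum_val i).
  rewrite /avg mxE mulr_suml [RHS]big_mkcond -sum_enum_val.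
  by apply: eq_bigr => j _; rewrite !mxE sedge_sym; case: ifP; rewrite ?mulr0.
have -> : \sum_x avg f x ^+ 2 = \sum_i (v *m adjmx R d G) 0 i ^+ 2.
  by rewrite -sum_enum_val; apply: eq_bigr => i _; rewrite vA.
have -> : \sum_x f x ^+ 2 = \sum_i v 0 i ^+ 2.
  by rewrite -sum_enum_val; apply: eq_bigr => i _; rewrite mxE.
apply: (@sum_sqr_mulmx_le _ _ _ (spectrum (adjmx R d G)) 1 _ (const_mx 1)) => //.
- exact: adjmx_sym.
- by apply: spectrumP; exact: adjmx_sym.
- by rewrite /rho le_max lexx.
- by rewrite lerNl /rho le_max lexx orbT.
- apply/eqP => /rowP/(_ (Ordinal G_gt0)); rewrite !mxE => /eqP.
  by rewrite oner_eq0.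
- apply/rowP => i; rewrite !mxE mulr1.
  transitivity (avg (fun=> 1) (enum_val i)); last by rewrite avg_const.
  rewrite /avg mulr_suml [RHS]big_mkcond -sum_enum_val.
  by apply: eq_bigr => j _; rewrite !mxE sedge_sym; case: ifP; rewrite ?mulr0.
- apply/matrixP => i j; rewrite !mxE -[RHS]f0 -sum_enum_val.
  by apply: eq_bigr => k _; rewrite !mxE mulr1.
Qed.

End Averaging.

(** * Counting nonbacktracking walks *)

Section NonbacktrackingWalks.
Variables (d : nat) (G : sgraph) (x0 : G).
Local Open Scope nat_scope.

(** The number of nonbacktracking walks of length k from a given vertex. *)
Definition nbtotal k : nat := if k is k'.+1 then d * d.-1 ^ k' else 1.

Lemma nbtotal_gt0 k : 1 < d -> 0 < nbtotal k.
Proof. by case: k => [|k] //=; rewrite muln_gt0 expn_gt0; case: d => [|[]]. Qed.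

Lemma sum_nbtotal_le (d_gt2 : 2 < d) K :
  \sum_(k < K.+1) nbtotal k <= d * d.-1 ^ K.
Proof.
elim: K => [|K IHK]; first by rewrite big_ord1 expn0 muln1 (leq_trans _ d_gt2).
rewrite big_ord_recr /=; apply: leq_trans (leq_add IHK (leqnn _)) _.
rewrite addnn -muln2 -mulnA leq_mul2l expnSr leq_mul2l.
by apply/orP; right; apply/orP; right; case: d d_gt2 => [|[|[]]].
Qed.

Hypotheses (d_gt0 : (0 < d)%N) (regG : regular d G).

(** The number of nonbacktracking walks of k.+1 steps from x0 whose last step
    goes from u to y: recording the last edge makes the nonbacktracking
    condition local. *)
Fixpoint nbw k (u y : G) : nat :=
  if k is k'.+1 then sedge u y * \sum_(w | w != y) nbw k' w u
  else sedge u y * (u == x0).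

Definition nbcount k (y : G) : nat :=
  if k is k'.+1 then \sum_u nbw k' u y else y == x0.

(** In how many ways a walk of k steps can be prolonged by one step without
    backtracking; an empty walk has no last edge to avoid. *)
Definition nbback k : nat := if k is k'.+1 then d.-1 else d.

Lemma nbw_edge k u y : ~~ sedge u y -> nbw k u y = 0.
Proof. by move=> /negPf e; case: k => [|k] /=; rewrite e mul0n. Qed.

Lemma sum_nbw_nbr k z :
  \sum_(y | sedge z y) nbw k z y = nbback k * nbcount k z.
Proof.
case: k => [|k] /=.
  under eq_bigr => y -> do rewrite mul1n.
  by rewrite sum_nat_const (card_nbr regG).
under eq_bigr => y -> do rewrite mul1n.
rewrite (exchange_big_dep xpredT) //= big_distrr /=; apply: eq_bigr => u _.
have [e|e] := boolP (sedge u z); last by rewrite nbw_edge // big1_eq muln0.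
rewrite sum_nat_const; congr (_ * _).
rewrite -(card_nbr regG z) [in RHS](cardD1 u) !inE sedge_sym e /=.
by apply: eq_card => y; rewrite !inE andbC eq_sym.
Qed.

Lemma nbcount1 z : nbcount 1 z = \sum_(y | sedge z y) nbcount 0 y.
Proof.
rewrite /= [RHS]big_mkcond; apply: eq_bigr => u _.
by rewrite sedge_sym; case: sedge; rewrite ?mul1n.
Qed.

(** A nonbacktracking walk of k.+1 steps followed by one step to z either
    stays nonbacktracking, or undoes its last step; what is then left is a walk
    of k steps ending at z, together with the undone edge. *)
Lemma sum_nbr_nbcount k z :
  \sum_(y | sedge z y) nbcount k.+1 y = nbcount k.+2 z + nbback k * nbcount k z.
Proof.
rewrite -sum_nbw_nbr [nbcount k.+2 z]/= [X in X + _](bigID (fun y => sedge z y)) /=.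
rewrite [X in _ + X + _]big1 ?addn0 => [|y]; last by rewrite sedge_sym => /negPf ->.
rewrite -big_split /=; apply: eq_bigr => y zy.
by rewrite sedge_sym zy mul1n (bigD1 z) //= addnC.
Qed.

Lemma sum_sum_nbr (a : G -> nat) : \sum_z \sum_(y | sedge z y) a y = d * \sum_y a y.
Proof.
rewrite (exchange_big_dep xpredT) //= big_distrr /=; apply: eq_bigr => y _.
rewrite sum_nat_const; congr (_ * _); rewrite -(card_nbr regG y).
by apply: eq_card => z; rewrite !inE sedge_sym.
Qed.

Lemma nbtotal_rec k : d * nbtotal k.+1 = nbtotal k.+2 + nbback k * nbtotal k.
Proof.
case: k => [|k] /=; rewrite !expnS ?expn0.
  by move: d_gt0; case: d => // e _ /=; ring.
by move: (d.-1 ^ k) d_gt0 => X; case: d => // e _ /=; ring.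
Qed.

Lemma sum_nbcount k : \sum_y nbcount k y = nbtotal k.
Proof.
have sum0 : \sum_y nbcount 0 y = 1.
  by rewrite /= (bigD1 x0) //= eqxx big1 // => y /negPf ->.
have sum1 : \sum_y nbcount 1 y = d.
  by under eq_bigr do rewrite nbcount1; rewrite sum_sum_nbr sum0 muln1.
suff [] : \sum_y nbcount k y = nbtotal k /\
  \sum_y nbcount k.+1 y = nbtotal k.+1 by [].
elim: k => [|k [IHk IHk1]]; first by rewrite sum0 sum1 /= expn0 muln1.
split=> //; apply: (@addIn (nbback k * nbtotal k)).
rewrite -nbtotal_rec -IHk1 -IHk -sum_sum_nbr big_distrr -big_split /=.
by apply: eq_bigr => z _; rewrite sum_nbr_nbcount.
Qed.

End NonbacktrackingWalks.

(** * The distance process on the regular tree *)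

Section RadialProcess.
Variables (R : realType) (d : nat).
Hypothesis d_gt2 : (2 < d)%N.
Implicit Types f g : nat -> R.

(** The transition operator of the distance K_t to the root of simple random
    walk on the d-regular tree: radial_step f k is the conditional expectation
    of f K_(t+1) given K_t = k. Working with this operator instead of the law
    of K_t avoids all summations over k. *)
Definition radial_step f (k : nat) : R :=
  if k is k'.+1 then (d%:R - 1) / d%:R * f k.+1 + d%:R^-1 * f k' else f 1%N.

(** The expectation of f K_t for the chain started at K_0 = 0. *)
Definition radial_mean t f : R := iter t radial_step f 0%N.

Definition speed : R := (d%:R - 2) / d%:R.

Let dR_gt2 : (2 : R) < d%:R. Proof. by rewrite ltr_nat. Qed.
Let dR_gt0 : (0 : R) < d%:R. Proof. by have := dR_gt2; lra. Qed.

Lemma iter_radial_step_sum (J : Type) (r : seq J) (P : pred J) (c : J -> R)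
    (F : J -> nat -> R) t k :
  iter t radial_step (fun k => \sum_(j <- r | P j) c j * F j k) k =
  \sum_(j <- r | P j) c j * iter t radial_step (F j) k.
Proof.
elim: t k => // t IHt k; rewrite iterS.
transitivity (radial_step
  (fun k => \sum_(j <- r | P j) c j * iter t radial_step (F j) k) k).
  by congr radial_step; apply/funext.
case: k => [|k]; rewrite /radial_step //= !mulr_sumr -big_split /=.
by apply: eq_bigr => j _; ring.
Qed.

Lemma le_iter_radial_step f g t k : (forall k, f k <= g k) ->
  iter t radial_step f k <= iter t radial_step g k.
Proof.
move=> fg; elim: t k => // t IHt k; rewrite !iterS.
case: k => [|k] //=; apply: lerD; apply: ler_wpM2l => //.
  by rewrite divr_ge0 //; have := dR_gt2; lra.
by rewrite invr_ge0 ltW.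
Qed.

Lemma radial_mean_sum (J : Type) (r : seq J) (P : pred J) (c : J -> R)
    (F : J -> nat -> R) t :
  radial_mean t (fun k => \sum_(j <- r | P j) c j * F j k) =
  \sum_(j <- r | P j) c j * radial_mean t (F j).
Proof. exact: iter_radial_step_sum. Qed.

Lemma le_radial_mean f g t : (forall k, f k <= g k) ->
  radial_mean t f <= radial_mean t g.
Proof. exact: le_iter_radial_step. Qed.

Lemma radial_mean_const c t : radial_mean t (fun=> c) = c.
Proof.
rewrite /radial_mean; suff -> : iter t radial_step (fun=> c) = fun=> c by [].
elim: t => // t IHt; rewrite iterS IHt; apply/funext => -[|k] //=.
by field; rewrite gt_eqF.
Qed.

Lemma radial_mean_affine f a b t :
  radial_mean t (fun k => a + b * f k) = a + b * radial_mean t f.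
Proof.
have := radial_mean_sum [:: true; false] xpredT (fun i : bool => if i then a else b)
  (fun i => if i then fun=> 1 else f) t.
under eq_fun do rewrite !big_cons big_nil /= mulr1 addr0.
by rewrite !big_cons big_nil /= radial_mean_const mulr1 addr0.
Qed.

(** Away from the root the increment of K_t - speed * t is centred with
    variance 1 - speed ^+ 2. At the root it is positive while
    K_t - speed * t <= 0, so the cross term can only decrease the square. *)
Lemma radial_mean_sqr_dev t :
  radial_mean t (fun k => (k%:R - speed * t%:R) ^+ 2) <= t%:R.
Proof.
elim: t => [|t IHt]; first by rewrite /radial_mean /= mulr0 subr0 expr0n.
rewrite /radial_mean iterSr -/(radial_mean _ _).
apply: le_trans
  (_ : radial_mean t (fun k => 1 + 1 * (k%:R - speed * t%:R) ^+ 2) <= _).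
  apply: le_radial_mean => -[|k] /=; rewrite -!(natr1 t).
    have v0 : 0 <= speed by rewrite divr_ge0 //; have := dR_gt2; lra.
    have v1 : speed <= 1 by rewrite ler_pdivrMr //; have := dR_gt2; lra.
    have t0 := ler0n R t.
    rewrite -subr_ge0; set X := (X in 0 <= X).
    have -> : X = speed * (2 * t%:R * (1 - speed) + (2 - speed)).
      by rewrite /X; ring.
    by rewrite mulr_ge0 // addr_ge0 ?mulr_ge0 ?subr_ge0 //; lra.
  rewrite -!natr1 -subr_ge0; set X := (X in 0 <= X).
  have -> : X = speed ^+ 2.
    by rewrite /X /speed; field; rewrite gt_eqF.
  exact: sqr_ge0.
by rewrite radial_mean_affine mul1r -natr1 addrC lerD2r.
Qed.

(** Chebyshev's inequality, integrated: outside the window of radius s around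
    speed * t the excess 1 is dominated by ((K_t - speed * t) / s) ^+ 2. *)
Lemma radial_mean_le f B s t : 0 < s -> 0 <= B ->
    (forall k, `|k%:R - speed * t%:R| < s -> f k <= B) ->
    (forall k, f k <= B + 1) ->
  radial_mean t f <= B + t%:R / s ^+ 2.
Proof.
move=> s0 B0 near far.
apply: le_trans (_ : radial_mean t
  (fun k => B + s ^- 2 * (k%:R - speed * t%:R) ^+ 2) <= _).
  apply: le_radial_mean => k.
  have [ks|ks] := ltP `|k%:R - speed * t%:R| s.
    apply: le_trans (near _ ks) _.
    by rewrite lerDl mulr_ge0 ?sqr_ge0 // invr_ge0 exprn_ge0 // ltW.
  apply: le_trans (far k) _; rewrite lerD2l mulrC ler_pdivlMr ?exprn_gt0 // mul1r.
  rewrite -[leRHS]real_normK ?num_real //.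
  by apply: lerXn2r; rewrite ?nnegrE // ltW.
rewrite radial_mean_affine lerD2l mulrC.
apply: ler_wpM2r; last exact: radial_mean_sqr_dev.
by rewrite invr_ge0 exprn_ge0 // ltW.
Qed.

End RadialProcess.

(** * Spectral decay of nonbacktracking walks *)
(** Cauchy-Schwarz, from the Lagrange identity. *)
Lemma sum_mul_sqr_le (R : realDomainType) (T : finType) (f g : T -> R) :
  (\sum_x f x * g x) ^+ 2 <= (\sum_x f x ^+ 2) * \sum_x g x ^+ 2.
Proof.
have dblE (a b : T -> R) : (\sum_x a x) * (\sum_y b y) = \sum_x \sum_y a x * b y.
  by rewrite mulr_suml; apply: eq_bigr => x _; rewrite mulr_sumr.
have : 0 <= \sum_x \sum_y (f x * g y - f y * g x) ^+ 2.
  by apply: sumr_ge0 => x _; apply: sumr_ge0 => y _; exact: sqr_ge0.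
have -> : \sum_x \sum_y (f x * g y - f y * g x) ^+ 2 =
    (\sum_x f x ^+ 2) * (\sum_x g x ^+ 2) + (\sum_x g x ^+ 2) * (\sum_x f x ^+ 2)
    - 2 * ((\sum_x f x * g x) * (\sum_x f x * g x)).
  rewrite !dblE mulr_sumr -big_split -sumrB; apply: eq_bigr => x _ /=.
  rewrite mulr_sumr -big_split -sumrB; apply: eq_bigr => y _ /=; ring.
by rewrite expr2; lra.
Qed.

(** For eta = 0 the increments are at most 1 and the growth is linear; in
    general an increase from e k to e k.+1 satisfies
    e k.+1 - e k <= 1 + eta * e k.+1. *)
Lemma linear_growth (R : realFieldType) (e : nat -> R) (eta : R) k :
    0 <= eta < 1 -> (forall k, 0 <= e k) -> e 0%N <= 1 ->
    (forall k, (e k.+1 - e k) ^+ 2 <= 1 + eta ^+ 2 * (e k * e k.+1)) ->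
  e k <= k.+1%:R / (1 - eta) ^+ k.
Proof.
move=> /andP[eta0 eta1] e_ge0 e0 step.
have eta'0 : 0 < 1 - eta by rewrite subr_gt0.
have grow j : e j.+1 * (1 - eta) <= e j + 1.
  have a0 := e_ge0 j; have b0 := e_ge0 j.+1; have st := step j.
  have eb : 0 <= eta * e j.+1 by rewrite mulr_ge0.
  have [ba|ab] := leP (e j.+1) (e j); first by lra.
  suff : e j.+1 - e j <= 1 + eta * e j.+1 by lra.
  rewrite -ler_sqr ?nnegrE ?subr_ge0 ?(ltW ab) ?addr_ge0 //.
  apply: le_trans st _.
  have : eta ^+ 2 * (e j * e j.+1) <= eta ^+ 2 * (e j.+1 * e j.+1).
    by apply: ler_wpM2l; [exact: sqr_ge0 | apply: ler_wpM2r => //; exact: ltW].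
  by rewrite sqrrD exprMn [e j.+1 ^+ 2]expr2; lra.
elim: k => [|k IHk]; first by rewrite expr0 divr1.
rewrite ler_pdivlMr ?exprn_gt0 // exprS mulrA.
rewrite ler_pdivlMr ?exprn_gt0 // in IHk.
apply: le_trans (ler_wpM2r (exprn_ge0 k (ltW eta'0)) (grow k)) _.
rewrite mulrDl mul1r -natr1 lerD // exprn_ile1 //; lra.
Qed.

Section SpectralDecay.
Variables (R : realType) (d : nat) (G : sgraph) (x0 : G).
Hypotheses (d_gt2 : (2 < d)%N) (regG : regular d G).

Let d_gt0 : (0 < d)%N. Proof. by apply: leq_trans d_gt2. Qed.
Let dR_gt2 : (2 : R) < d%:R. Proof. by rewrite ltr_nat. Qed.
Let dR_gt0 : (0 : R) < d%:R. Proof. by rewrite ltr0n. Qed.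
Let G_gt0 : (0 : R) < #|G|%:R.
Proof. by rewrite ltr0n; apply/card_gt0P; exists x0. Qed.

(** The law nu_k of the endpoint of a uniform nonbacktracking walk of k steps
    from x0. *)
Definition nbdistr k (x : G) : R := (nbcount x0 k x)%:R / (nbtotal d k)%:R.

Lemma nbtotalR_gt0 k : (0 : R) < (nbtotal d k)%:R.
Proof. by rewrite ltr0n nbtotal_gt0 // ltnW. Qed.

Lemma nbdistr_ge0 k x : 0 <= nbdistr k x.
Proof. by rewrite divr_ge0. Qed.

Lemma sum_nbdistr k : \sum_x nbdistr k x = 1.
Proof.
rewrite -mulr_suml -natr_sum (sum_nbcount x0 d_gt0) // divff //.
by rewrite gt_eqF // nbtotalR_gt0.
Qed.

(** Averaging acts on the family nu_k, as a function of k, like one step of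
    the distance process. *)
Lemma avg_nbdistr k x : avg d (nbdistr k) x = radial_step d (nbdistr ^~ x) k.
Proof.
rewrite /avg -mulr_suml -natr_sum; case: k => [|k].
  by rewrite -nbcount1 /radial_step /nbdistr /= expn0 muln1 divr1.
rewrite (sum_nbr_nbcount _ regG) /radial_step /nbdistr.
have dE : (d%:R : R) - 1 = d.-1%:R by rewrite -subn1 natrB.
have tE : (nbtotal d k.+2)%:R = (d%:R - 1) * (nbtotal d k.+1)%:R :> R.
  by rewrite dE -natrM /= expnS mulnCA.
have bE : (nbback d k)%:R * (nbtotal d k)%:R = (nbtotal d k.+1)%:R :> R.
  rewrite -natrM; congr _%:R; case: (k) => [|k'] /=; first by rewrite expn0.
  by rewrite expnS mulnCA.
have t0 := nbtotalR_gt0 k; have t1 := nbtotalR_gt0 k.+1.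
have b0 : (nbback d k)%:R != 0 :> R.
  by apply: contraTneq t1 => b0; rewrite -bE b0 mul0r ltxx.
rewrite tE natrD natrM -bE; field.
by rewrite b0 !gt_eqF //; have := dR_gt2; lra.
Qed.

Lemma walk_distr_radial t x :
  walk_distr R d x0 t x = radial_mean d t (nbdistr ^~ x).
Proof.
rewrite walk_distrE // /radial_mean.
have <- : nbdistr 0 = (fun x => (x == x0)%:R).
  by apply/funext => y; rewrite /nbdistr /= divr1.
elim: t 0%N x => // t IHt k x; rewrite iterS iterSr /avg mulrC mulr_sumr.
under eq_bigr do rewrite IHt.
rewrite -iter_radial_step_sum; congr (iter _ _ _ _); apply/funext => j.
by rewrite -avg_nbdistr /avg mulrC mulr_sumr.
Qed.

Definition nbdev k (x : G) : R := nbdistr k x - #|G|%:R^-1.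

Lemma sum_nbdev k : \sum_x nbdev k x = 0.
Proof.
rewrite sumrB sum_nbdistr sumr_const -(mulr_natr _^-1) mulVf ?subrr //.
by rewrite gt_eqF.
Qed.

Lemma avg_nbdev k x : avg d (nbdev k) x = radial_step d (nbdev ^~ x) k.
Proof.
rewrite /avg sumrB mulrBl -/(avg d _ x) avg_nbdistr.
rewrite (sum_nbr_const regG) mulfK ?gt_eqF //.
case: k => [|k] //=; rewrite /nbdev; field.
by rewrite !gt_eqF.
Qed.

Let q : R := Num.sqrt (d%:R - 1).

Let q_gt0 : 0 < q. Proof. by rewrite sqrtr_gt0; have := dR_gt2; lra. Qed.
Let q_sqr : q ^+ 2 = d%:R - 1.
Proof. by rewrite sqr_sqrtr //; have := dR_gt2; lra. Qed.

(** With this normalisation the two coefficients in the recurrence for nu_k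
    become equal, whence the Chebyshev recurrence MS below. *)
Let M k x : R := q ^+ k * nbdev k x.

Let avgM k x : avg d (M k) x = q ^+ k * avg d (nbdev k) x.
Proof. by rewrite /avg /M -mulr_sumr mulrA. Qed.

Let M1 x : M 1 x = q * avg d (M 0) x.
Proof. by rewrite avgM avg_nbdev /M expr1 expr0 mul1r. Qed.

Let MS k x : M k.+2 x = d%:R / q * avg d (M k.+1) x - M k x.
Proof.
rewrite avgM avg_nbdev /M /= !exprS -q_sqr; field.
by rewrite !gt_eqF.
Qed.

(** If T is a number 2 cos(phi), so that M_k combines exp(i k phi) and
    exp(- i k phi), this is |M_(k+1) - exp(i phi) M_k| ^ 2, which does not
    depend on k. *)
Let energy k := \sum_x M k.+1 x ^+ 2 - d%:R / q * (\sum_x avg d (M k) x * M k.+1 x)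
   + \sum_x M k x ^+ 2.

Let energyS k : energy k.+1 = energy k.
Proof.
rewrite /energy.
have -> : \sum_x M k.+2 x ^+ 2 = (d%:R / q) ^+ 2 * (\sum_x avg d (M k.+1) x ^+ 2)
   - 2 * (d%:R / q) * (\sum_x avg d (M k.+1) x * M k x) + \sum_x M k x ^+ 2.
  rewrite !mulr_sumr -sumrB -big_split; apply: eq_bigr => x _.
  by rewrite MS /=; ring.
have -> : \sum_x avg d (M k.+1) x * M k.+2 x =
    d%:R / q * (\sum_x avg d (M k.+1) x ^+ 2) - \sum_x avg d (M k.+1) x * M k x.
  rewrite !mulr_sumr -sumrB; apply: eq_bigr => x _.
  by rewrite MS; ring.
rewrite (dot_avgC _ (M k)).
under [\sum_x M k x * _]eq_bigr do rewrite mulrC.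
ring.
Qed.

Let M0_sqr : \sum_x M 0 x ^+ 2 = 1 - #|G|%:R^-1.
Proof.
transitivity (\sum_x (nbdistr 0 x - 2 / #|G|%:R * nbdistr 0 x + #|G|%:R ^- 2)).
  apply: eq_bigr => x _; rewrite /M /nbdev /nbdistr expr0 mul1r divr1 /=.
  by case: eqP => _ /=; field; rewrite gt_eqF.
rewrite big_split sumrB -mulr_sumr sum_nbdistr sumr_const -(mulr_natr (_ ^- 2)) /=.
by field; rewrite gt_eqF.
Qed.

(** Since M_1 = q P M_0 and q ^+ 2 = d - 1, the initial energy is
    |M_0|^2 - |P M_0|^2, and |M_0| <= 1. *)
Let energy_le1 k : energy k <= 1.
Proof.
have -> : energy k = energy 0 by elim: k => // k <-; exact: energyS.
rewrite /energy.
have -> : \sum_x M 1 x ^+ 2 = q ^+ 2 * \sum_x avg d (M 0) x ^+ 2.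
  by rewrite mulr_sumr; apply: eq_bigr => x _; rewrite M1 exprMn.
have -> : \sum_x avg d (M 0) x * M 1 x = q * \sum_x avg d (M 0) x ^+ 2.
  by rewrite mulr_sumr; apply: eq_bigr => x _; rewrite M1; ring.
rewrite M0_sqr mulrA divfK ?gt_eqF // q_sqr.
have n0 : 0 <= #|G|%:R^-1 :> R by rewrite invr_ge0 ltW.
have s0 : 0 <= \sum_x avg d (M 0) x ^+ 2.
  by apply: sumr_ge0 => x _; exact: sqr_ge0.
by lra.
Qed.

(** The energy bound reads (e (k+1) - e k)^2 <= 1 + (|T| - 2) e k e (k+1) for
    e k = |M_k|, where |T| <= d r / sqrt(d-1) is the norm of T on the functions
    of sum 0. *)
Lemma norm_nbdev_le r eta k : 0 <= r -> 0 <= eta < 1 ->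
    (forall f : G -> R, \sum_x f x = 0 ->
       \sum_x avg d f x ^+ 2 <= r ^+ 2 * \sum_x f x ^+ 2) ->
    d%:R * r <= (2 + eta ^+ 2) * Num.sqrt (d%:R - 1) ->
  Num.sqrt (\sum_x nbdev k x ^+ 2)
    <= k.+1%:R / (Num.sqrt (d%:R - 1) * (1 - eta)) ^+ k.
Proof.
rewrite -/q => r0 /andP[eta0 eta1] contr rle.
pose e k := Num.sqrt (\sum_x M k x ^+ 2).
have sqr_ge j : 0 <= \sum_x M j x ^+ 2 by apply: sumr_ge0 => x _; exact: sqr_ge0.
have e_sqr j : e j ^+ 2 = \sum_x M j x ^+ 2 by rewrite sqr_sqrtr.
have e_ge0 j : 0 <= e j by exact: sqrtr_ge0.
have sumM j : \sum_x M j x = 0 by rewrite -mulr_sumr sum_nbdev mulr0.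
have eE : e k = q ^+ k * Num.sqrt (\sum_x nbdev k x ^+ 2).
  rewrite /e; under eq_bigr do rewrite exprMn.
  by rewrite -mulr_sumr sqrtrM ?sqr_ge0 // sqrtr_sqr ger0_norm // exprn_ge0 // ltW.
suff ek : e k <= k.+1%:R / (1 - eta) ^+ k.
  rewrite exprMn invfM mulrCA mulrC ler_pdivlMr ?exprn_gt0 //.
  by rewrite mulrC -eE.
apply: linear_growth => //; first by rewrite eta0.
  rewrite -(@ler_sqr R) ?nnegrE // e_sqr M0_sqr expr1n.
  by rewrite lerBlDr lerDl invr_ge0 ltW.
move=> j.
have inner : \sum_x avg d (M j) x * M j.+1 x <= r * (e j * e j.+1).
  rewrite (le_trans (ler_norm _)) // -ler_sqr ?nnegrE ?mulr_ge0 //.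
  rewrite real_normK ?num_real // (le_trans (sum_mul_sqr_le _ _)) //.
  rewrite !exprMn !e_sqr mulrA; apply: ler_wpM2r => //; exact: contr.
have dq : 0 <= d%:R / q by rewrite divr_ge0 // ltW.
have drq : d%:R / q * r <= 2 + eta ^+ 2.
  by rewrite mulrAC ler_pdivrMr.
have := energy_le1 j; rewrite /energy -!e_sqr => E1.
have := ler_wpM2l dq inner; rewrite mulrA.
have := ler_wpM2r (mulr_ge0 (e_ge0 j) (e_ge0 j.+1)) drq.
rewrite mulrDl sqrrB; lra.
Qed.

Lemma set_nbdev_le (A : {set G}) r eta k : 0 <= r -> 0 <= eta < 1 ->
    (forall f : G -> R, \sum_x f x = 0 ->
       \sum_x avg d f x ^+ 2 <= r ^+ 2 * \sum_x f x ^+ 2) ->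
    d%:R * r <= (2 + eta ^+ 2) * Num.sqrt (d%:R - 1) ->
  `|\sum_(x in A) nbdev k x| <= Num.sqrt #|G|%:R *
     (k.+1%:R / (Num.sqrt (d%:R - 1) * (1 - eta)) ^+ k).
Proof.
move=> r0 eta01 contr rle.
apply: le_trans (ler_wpM2l (sqrtr_ge0 _) (norm_nbdev_le k r0 eta01 contr rle)).
rewrite -sqrtrM ?(ltW G_gt0) // -sqrtr_sqr; apply: ler_wsqrtr.
rewrite big_mkcond /=.
under eq_bigr do rewrite -mulrb -mulr_natl.
apply: le_trans (sum_mul_sqr_le _ _) _; apply: ler_wpM2r.
  by apply: sumr_ge0 => x _; exact: sqr_ge0.
rewrite -[leRHS]sumr_const; apply: ler_sum => x _.
by case: (x \in A) => /=; rewrite ?expr1n ?expr0n.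
Qed.

End SpectralDecay.

(** * Bounds on the mixing of the walk at a given time *)
Section MixingTime.
Variables (R : realType) (d : nat) (G : sgraph) (x0 : G).
Hypotheses (d_gt2 : (2 < d)%N) (regG : regular d G).

Let d_gt0 : (0 < d)%N. Proof. by apply: leq_trans d_gt2. Qed.
Let G_gt0 : (0 : R) < #|G|%:R.
Proof. by rewrite ltr0n; apply/card_gt0P; exists x0. Qed.

Lemma sum_uniform (A : {set G}) :
  \sum_(x in A) uniform_distr R x = #|A|%:R / #|G|%:R.
Proof. by rewrite sumr_const -(mulr_natl _^-1). Qed.

Lemma sum_walk_distr (A : {set G}) t : \sum_(x in A) walk_distr R d x0 t x =
  radial_mean d t (fun k => \sum_(x in A) nbdistr R d x0 k x).
Proof.
transitivity (radial_mean d t (fun k => \sum_(x in A) 1 * nbdistr R d x0 k x)).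
  rewrite radial_mean_sum; apply: eq_bigr => x _.
  by rewrite mul1r; apply: walk_distr_radial.
congr radial_mean; apply/funext => k.
by apply: eq_bigr => x _; rewrite mul1r.
Qed.

Lemma sum_set_nbdistr_bounds (A : {set G}) k :
  0 <= \sum_(x in A) nbdistr R d x0 k x <= 1.
Proof.
rewrite sumr_ge0 => [|x _]; last exact: nbdistr_ge0.
rewrite -(sum_nbdistr R x0 d_gt2 regG k) [leRHS](bigID (mem A)) /= lerDl.
by apply: sumr_ge0 => x _; exact: nbdistr_ge0.
Qed.

Lemma sum_set_nbdev (A : {set G}) k : \sum_(x in A) nbdev R d x0 k x =
  \sum_(x in A) nbdistr R d x0 k x - #|A|%:R / #|G|%:R.
Proof. by rewrite sumrB sumr_const -(mulr_natl _^-1). Qed.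

Lemma set_walk_dev_le (A : {set G}) t (B s : R) : 0 < s -> 0 <= B ->
    (forall k, `|k%:R - speed R d * t%:R| < s ->
       `|\sum_(x in A) nbdev R d x0 k x| <= B) ->
  `|\sum_(x in A) walk_distr R d x0 t x - \sum_(x in A) uniform_distr R x|
    <= B + t%:R / s ^+ 2.
Proof.
move=> s0 B0 near; rewrite sum_walk_distr sum_uniform.
pose f k := \sum_(x in A) nbdev R d x0 k x.
have fE c : radial_mean d t (fun k => 0 + c * f k) =
    c * (radial_mean d t (fun k => \sum_(x in A) nbdistr R d x0 k x)
         - #|A|%:R / #|G|%:R).
  rewrite (radial_mean_affine d_gt2) add0r; congr (c * _).
  rewrite addrC -[X in _ + X]mul1r -(radial_mean_affine d_gt2).
  by congr radial_mean; apply/funext => k; rewrite mul1r addrC /f sum_set_nbdev.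
have AG : 0 <= (#|A|%:R / #|G|%:R : R) <= 1.
  by rewrite divr_ge0 //= ler_pdivrMr // mul1r ler_nat max_card.
have f1 k : `|f k| <= B + 1.
  have := sum_set_nbdistr_bounds A k; rewrite /f sum_set_nbdev.
  by move: AG => /andP[? ?] /andP[? ?]; rewrite ler_norml; apply/andP; split; lra.
have mean_le : radial_mean d t (fun k => `|f k|) <= B + t%:R / s ^+ 2.
  exact: radial_mean_le.
apply: le_trans mean_le; rewrite ler_norml lerNl; apply/andP; split.
  rewrite -mulN1r -fE; apply: le_radial_mean => // k.
  by rewrite add0r mulN1r -normrN ler_norm.
rewrite -[leLHS]mul1r -fE; apply: le_radial_mean => // k.
by rewrite add0r mul1r ler_norm.
Qed.

Lemma mixed_of_nbdev t (alpha B s : R) : 0 < s -> 0 <= B ->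
    (forall k (A : {set G}), `|k%:R - speed R d * t%:R| < s ->
       `|\sum_(x in A) nbdev R d x0 k x| <= B) ->
    B + t%:R / s ^+ 2 < alpha ->
  mixed d x0 alpha t.
Proof.
move=> s0 B0 near lt_alpha; apply: le_lt_trans lt_alpha.
apply/bigmax_leP; split; first by rewrite addr_ge0 // divr_ge0 // exprn_ge0 // ltW.
by move=> A _; apply: set_walk_dev_le => // k ks; exact: near.
Qed.

(** The set that separates the two laws consists of the endpoints of the
    nonbacktracking walks of at most K steps. *)
Lemma not_mixed_of_ball t K (alpha s : R) : 0 < s ->
    (forall k, `|k%:R - speed R d * t%:R| < s -> (k <= K)%N) ->
    (d * d.-1 ^ K)%:R / #|G|%:R + t%:R / s ^+ 2 <= 1 - alpha ->
  ~~ mixed d x0 alpha t.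
Proof.
move=> s0 near le_alpha; rewrite /mixed -leNgt.
pose A := [set y : G | [exists k : 'I_K.+1, 0 < nbcount x0 k y]%N].
have cardA : (#|A| <= d * d.-1 ^ K)%N.
  apply: leq_trans _ (sum_nbtotal_le d_gt2 K).
  under eq_bigr do rewrite -(sum_nbcount x0 d_gt0 regG).
  rewrite exchange_big -sum1_card big_mkcond; apply: leq_sum => y _ /=.
  rewrite inE; case: existsP => // -[k yk].
  by rewrite (bigD1 k) //= (leq_trans yk) // leq_addr.
have walkA : 1 - t%:R / s ^+ 2 <= \sum_(x in A) walk_distr R d x0 t x.
  rewrite sum_walk_distr lerBlDr addrC -lerBlDr -[X in _ - X]mul1r -mulNr.
  rewrite -(radial_mean_affine d_gt2) -[leRHS]add0r.
  apply: radial_mean_le => // k; last first.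
    by have := sum_set_nbdistr_bounds A k => /andP[? ?]; lra.
  move=> /near kK; rewrite mulN1r subr_le0.
  rewrite -(sum_nbdistr R x0 d_gt2 regG k) [leLHS](bigID (mem A)) /=.
  rewrite [X in _ + X]big1 ?addr0 // => x; rewrite inE => /existsPn/(_ (inord k)).
  by rewrite inordK // lt0n negbK => /eqP xk; rewrite /nbdistr xk mul0r.
apply: (bigmax_sup A) => //.
apply: le_trans (ler_norm _); rewrite sum_uniform.
have : #|A|%:R / #|G|%:R <= (d * d.-1 ^ K)%:R / #|G|%:R :> R.
  by rewrite ler_pM2r ?invr_gt0 // ler_nat.
lra.
Qed.

End MixingTime.

(** * Asymptotics in the size of the graph *)
Lemma sqrt_expR (R : realType) (x : R) : Num.sqrt (expR x) = expR (x / 2).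
Proof.
have -> : expR x = expR (x / 2) ^+ 2 by rewrite -expRM_natl; congr expR; field.
by rewrite sqrtr_sqr ger0_norm // expR_ge0.
Qed.

Lemma expRN_le_inv (R : realType) (x : R) : 0 < x -> expR (- x) <= x^-1.
Proof.
move=> x0; rewrite expRN lef_pV2 ?posrE ?expR_gt0 //.
by apply: le_trans (expR_ge1Dx x); rewrite lerDr.
Qed.

Lemma natSr_expRN_le (R : realType) (c : R) k : 0 < c -> (0 < k)%N ->
  k.+1%:R * expR (- (c * k%:R)) <= 4 / (c ^+ 2 * k%:R).
Proof.
move=> c0 k0; have k1 : 1 <= k%:R :> R by rewrite ler1n.
have ck : 0 < c * k%:R by rewrite mulr_gt0 // ltr0n.
rewrite expRN ler_pdivrMr ?expR_gt0 //.
apply: le_trans (_ : 4 / (c ^+ 2 * k%:R) * ((c * k%:R) ^+ 2 / 2) <= _).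
  have -> : 4 / (c ^+ 2 * k%:R) * ((c * k%:R) ^+ 2 / 2) = 2 * k%:R.
    by field; rewrite !gt_eqF //; lra.
  by rewrite -natr1; lra.
apply: ler_wpM2l; first by rewrite divr_ge0 // mulr_ge0 // exprn_ge0 // ltW.
by have := expR_ge1Dxn 1 (ltW ck); rewrite (_ : 2`! = 2)%N //; lra.
Qed.

Section Asymptotics.
Variables (R : realType) (d : nat).
Hypothesis d_gt2 : (2 < d)%N.

Let dR_gt2 : (2 : R) < d%:R. Proof. by rewrite ltr_nat. Qed.
Let b : R := ln (d%:R - 1).
Let v : R := speed R d.

Let b_gt0 : 0 < b. Proof. by rewrite ln_gt0 //; have := dR_gt2; lra. Qed.
Let v_gt0 : 0 < v. Proof. by rewrite divr_gt0 //; have := dR_gt2; lra. Qed.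
Let v_lt1 : v < 1. Proof. by rewrite ltr_pdivrMr; have := dR_gt2; lra. Qed.
Let expRb : expR b = d%:R - 1.
Proof. by rewrite lnK // posrE; have := dR_gt2; lra. Qed.
Let expRbM k : expR (b * k%:R) = (d%:R - 1) ^+ k.
Proof. by rewrite mulrC expRM_natl expRb. Qed.

Definition log_size (G : sgraph) : R := ln #|G|%:R / ln (d%:R - 1).

Let expR_log_size (G : sgraph) : (0 < #|G|)%N -> expR (b * log_size G) = #|G|%:R.
Proof. by move=> G0; rewrite mulrC divfK ?gt_eqF // lnK // posrE ltr0n. Qed.

(** At time t < (1 - eps) L / v, where L is log_size G, the walk has gone at
    most (1 - eps / 2) L away from the root, up to deviations of order
    sqrt t = o(L), while |G| = (d-1)^L. *)
Lemma not_mixed_before (alpha eps : R) : 0 < alpha < 1 -> 0 < eps < 1 ->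
  exists L0 : R, forall (G : sgraph) (x0 : G) t, regular d G ->
    L0 <= log_size G -> t%:R < (1 - eps) * log_size G / v ->
    ~~ mixed d x0 alpha t.
Proof.
move=> /andP[a0 a1] /andP[e0 e1].
exists (4 * d%:R / (b * eps * (1 - alpha)) + 8 / (v * eps ^+ 2 * (1 - alpha))).
move=> G x0 t regG; set L := log_size G => L0 tL.
have G0 : (0 < #|G|)%N by apply/card_gt0P; exists x0.
have d0 : 0 < d%:R :> R by have := dR_gt2; lra.
have a1' : 0 < 1 - alpha by rewrite subr_gt0.
have X1 : 0 < 4 * d%:R / (b * eps * (1 - alpha)) by rewrite divr_gt0 ?mulr_gt0.
have D2 : 0 < v * eps ^+ 2 * (1 - alpha).
  by apply: mulr_gt0 => //; apply: mulr_gt0 => //; exact: exprn_gt0.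
have X2 : 0 < 8 / (v * eps ^+ 2 * (1 - alpha)) by exact: divr_gt0.
have Lgt0 : 0 < L by lra.
have s0 : 0 < eps * L / 2 by apply: divr_gt0 => //; exact: mulr_gt0.
have vt : v * t%:R < (1 - eps) * L by rewrite mulrC -ltr_pdivlMr.
apply: (@not_mixed_of_ball R d G x0 d_gt2 regG t
  (Num.truncn ((1 - eps / 2) * L)) alpha (eps * L / 2) s0).
  move=> k; rewrite -/v => /ltr_normlP[_ kt].
  rewrite truncn_ge_nat; last by rewrite mulr_ge0 ?(ltW Lgt0) //; lra.
  by lra.
set K := Num.truncn _.
have KL : K%:R <= (1 - eps / 2) * L.
  by rewrite truncn_le mulr_ge0 ?(ltW Lgt0) //; lra.
have dev : t%:R / (eps * L / 2) ^+ 2 <= (1 - alpha) / 2.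
  rewrite ler_pdivrMr ?exprn_gt0 //.
  have tv : t%:R <= L / v.
    rewrite ler_pdivlMr // mulrC (le_trans (ltW vt)) //.
    by rewrite ler_piMl ?(ltW Lgt0) //; lra.
  apply: le_trans tv _; rewrite ler_pdivrMr //.
  have : 8 / (v * eps ^+ 2 * (1 - alpha)) <= L by lra.
  rewrite ler_pdivrMr // => /(ler_wpM2r (ltW Lgt0)); lra.
rewrite [1 - alpha]splitr lerD //.
rewrite natrM natrX -subn1 natrB; last by apply: leq_trans d_gt2.
rewrite -expRbM -expR_log_size // -mulrA -expRN -expRD.
apply: le_trans (_ : d%:R * expR (- (b * (eps / 2) * L)) <= _).
  rewrite ler_pM2l // ler_expR -/L.
  by have := ler_wpM2l (ltW b_gt0) KL; lra.
have x0' : 0 < b * (eps / 2) * L.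
  by apply: mulr_gt0 => //; apply: mulr_gt0 => //; exact: divr_gt0.
apply: le_trans (ler_wpM2l (ltW d0) (expRN_le_inv x0')) _.
rewrite ler_pdivrMr //.
have : 4 * d%:R / (b * eps * (1 - alpha)) <= L by lra.
rewrite ler_pdivrMr ?mulr_gt0 //; lra.
Qed.

(** The time is t, the integer part of (1 + eps) L / v, where L is log_size G;
    then K_t is at least (1 + eps / 4) L with high probability. *)
Lemma mixed_soon_after (alpha eps : R) : 0 < alpha < 1 -> 0 < eps < 1 ->
  exists delta L0 : R, 0 < delta /\ forall (G : sgraph) (x0 : G), regular d G ->
    `|rho R d G - 2 * Num.sqrt (d%:R - 1) / d%:R| < delta -> L0 <= log_size G ->
    exists2 t, t%:R <= (1 + eps) * log_size G / v & mixed d x0 alpha t.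
Proof.
move=> /andP[a0 a1] /andP[e0 e1].
have d0 : 0 < d%:R :> R by have := dR_gt2; lra.
set q := Num.sqrt (d%:R - 1).
have qE : q = expR (b / 2) by rewrite -sqrt_expR expRb.
have q_sqr : q ^+ 2 = d%:R - 1 by rewrite sqr_sqrtr //; have := dR_gt2; lra.
have q0 : 0 < q by rewrite qE expR_gt0.
have q2d : 2 * q < d%:R.
  have q1 : q - 1 != 0.
    apply/eqP => q1; have : q ^+ 2 = 1 by rewrite (subr0_eq q1) expr1n.
    by rewrite q_sqr; have := dR_gt2; lra.
  have : 0 < (q - 1) ^+ 2 by rewrite lt_def sqrf_eq0 q1 sqr_ge0.
  by rewrite sqrrB expr1n q_sqr; lra.
(* For k >= (1 + eps / 4) L and eps < 1,
   sqrt |G| / q^k = exp (b (L - k) / 2) <= exp (- (b eps / 10) k).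
   Half of this exponent, c, pays for the factor (1 - eta)^-k, and the other
   half beats the factor k + 1. *)
pose c := b * eps / 20.
have c0 : 0 < c by apply: divr_gt0 => //; exact: mulr_gt0.
pose eta := 1 - expR (- c).
have eta01 : 0 < eta < 1.
  by rewrite subr_gt0 gtrBl expR_gt0 andbT expR_lt1 oppr_lt0.
have /andP[eta0 eta1] := eta01.
(* The first term makes d rho_G / q at most 2 + eta ^ 2, the second keeps
   rho_G below 1. *)
pose delta := Num.min (eta ^+ 2 * q / d%:R) (1 - 2 * q / d%:R).
have delta0 : 0 < delta.
  rewrite lt_min; apply/andP; split.
    by apply: divr_gt0 => //; apply: mulr_gt0 => //; exact: exprn_gt0.
  by rewrite subr_gt0 ltr_pdivrMr // mul1r.
have D1 : 0 < v * eps ^+ 2 * alpha.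
  by apply: mulr_gt0 => //; apply: mulr_gt0 => //; exact: exprn_gt0.
have D2 : 0 < c ^+ 2 * alpha by apply: mulr_gt0 => //; exact: exprn_gt0.
pose L1 := 96 / (v * eps ^+ 2 * alpha); pose L2 := 12 / (c ^+ 2 * alpha).
have L1_gt0 : 0 < L1 by exact: divr_gt0.
have L2_gt0 : 0 < L2 by exact: divr_gt0.
have e2 : 0 < 2 / eps by exact: divr_gt0.
exists delta, (2 / eps + L1 + L2); split=> // G x0 regG rho_lt.
set L := log_size G => L0.
have G0 : (0 < #|G|)%N by apply/card_gt0P; exists x0.
have Lgt0 : 0 < L by lra.
have Le : 2 <= L * eps by rewrite -ler_pdivrMr //; lra.
have [rho_hi rho_lo] : rho R d G < 2 * q / d%:R + delta /\
    - (2 * q / d%:R + delta) <= rho R d G.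
  have q2 : 0 < 2 * q / d%:R by rewrite divr_gt0 // mulr_gt0.
  by move: rho_lt; rewrite ltr_norml => /andP[? ?]; split; lra.
have rho_lt1 : rho R d G < 1.
  by apply: lt_le_trans rho_hi _; rewrite addrC -lerBrDr ge_min lexx orbT.
have rho_le : d%:R * `|rho R d G| <= (2 + eta ^+ 2) * q.
  have : `|rho R d G| <= (2 + eta ^+ 2) * q / d%:R.
    have : delta <= eta ^+ 2 * q / d%:R by rewrite ge_min lexx.
    by rewrite ler_norml mulrDl mulrDl => ?; apply/andP; split; lra.
  by rewrite ler_pdivlMr // mulrC.
set tR := (1 + eps) * L / v.
have tR0 : 0 <= tR.
  by apply: divr_ge0; [apply: mulr_ge0; [lra | exact: ltW] | exact: ltW].
have tv : tR * v = (1 + eps) * L by rewrite divfK // gt_eqF.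
exists (Num.truncn tR); first by rewrite truncn_le.
set t := Num.truncn tR.
have /andP[t_le t_gt] : t%:R <= tR < t.+1%:R by exact: truncn_itv.
have s0 : 0 < eps * L / 4 by apply: divr_gt0 => //; exact: mulr_gt0.
have a3 : 0 <= alpha / 3 by lra.
have vt : (1 + eps / 2) * L <= v * t%:R.
  have : v * tR <= v * t%:R + v.
    by rewrite -[X in _ <= _ + X]mulr1 -mulrDr natr1 ler_pM2l // ltW.
  by rewrite mulrC tv; have := v_lt1; lra.
apply: (@mixed_of_nbdev R d G x0 d_gt2 regG t alpha
  (alpha / 3) (eps * L / 4)) => //.
  move=> k A; rewrite -/v => /ltr_normlP[kt _].
  have kL : (1 + eps / 4) * L <= k%:R by lra.
  have contr (f : G -> R) : \sum_x f x = 0 ->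
      \sum_x avg d f x ^+ 2 <= `|rho R d G| ^+ 2 * \sum_x f x ^+ 2.
    move=> f0; rewrite real_normK ?num_real //.
    apply: (avg_contraction _ regG) => //; exact: leq_trans d_gt2.
  have eta01' : 0 <= eta < 1 by rewrite ltW.
  apply: le_trans
    (set_nbdev_le x0 d_gt2 regG A k (normr_ge0 _) eta01' contr rho_le) _.
  rewrite -expR_log_size // sqrt_expR -/L -/q qE /eta opprB addrC subrK.
  rewrite -expRD -expRM_natl -expRN mulrCA -expRD.
  have Lk : L <= k%:R by rewrite (le_trans _ kL) // ler_peMl ?(ltW Lgt0) //; lra.
  have kgt0 : 0 < k%:R :> R by lra.
  have k0 : (0 < k)%N by rewrite -(ltr_nat R).
  apply: le_trans (_ : k.+1%:R * expR (- (c * k%:R)) <= _).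
    rewrite ler_pM2l ?ltr0n // ler_expR /c.
    have : b * L * (1 + eps / 4) <= b * k%:R.
      by rewrite -mulrA [L * _]mulrC ler_pM2l.
    have e5 : 0 <= 1 - eps / 5 by lra.
    have bL : 0 <= b * L * (eps * (1 - eps)).
      by apply: mulr_ge0; [apply: mulr_ge0; exact: ltW | apply: mulr_ge0; lra].
    by move=> /(ler_wpM2l e5); lra.
  apply: le_trans (natSr_expRN_le c0 k0) _.
  rewrite ler_pdivrMr; last by apply: mulr_gt0 => //; exact: exprn_gt0.
  have : L2 <= k%:R by lra.
  by rewrite ler_pdivrMr //; lra.
apply: le_lt_trans (_ : alpha / 3 + alpha / 3 < _); last by lra.
rewrite lerD2l ler_pdivrMr; last exact: exprn_gt0.
apply: le_trans t_le _; rewrite ler_pdivrMr //.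
have : L1 <= L by lra.
rewrite ler_pdivrMr // => /(ler_wpM2r (ltW Lgt0)).
have : eps * L <= L by rewrite ler_piMl ?(ltW Lgt0) // ltW.
lra.
Qed.

End Asymptotics.

(** * The cutoff window *)
Lemma Tmix_bounds (R : realType) d (G : sgraph) (x0 : G) (alpha lo hi : R) :
    (forall t, t%:R < lo -> ~~ mixed d x0 alpha t) ->
    (exists2 t, t%:R <= hi & mixed d x0 alpha t) ->
  lo <= (Tmix d x0 alpha)%:R <= hi.
Proof.
move=> before [t t_hi mix_t]; rewrite /Tmix.
case: pselect => [h|[]]; last by exists t.
case: ex_minnP => m mix_m min_m; apply/andP; split.
  by rewrite leNgt; apply/negP => /before; rewrite mix_m.
by apply: le_trans t_hi; rewrite ler_nat min_m.
Qed.

Section Family.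
Variables (R : realType) (d : nat) (I : Type) (G : I -> sgraph).
Hypotheses (d_gt2 : (2 < d)%N)
  (regG : forall i, regular d (G i))
  (ramanujan : asymptotically_Ramanujan R G d).

Let cutoff_const : R := d%:R / ((d%:R - 2) * ln (d%:R - 1)).

Let dR_gt2 : (2 : R) < d%:R. Proof. by rewrite ltr_nat. Qed.

Let cutoff_const_gt0 : 0 < cutoff_const.
Proof.
have := dR_gt2 => d2; apply: divr_gt0; first by lra.
by apply: mulr_gt0; [lra | rewrite ln_gt0 //; lra].
Qed.

Let log_size_speed i :
  log_size R d (G i) / speed R d = cutoff_const * ln #|G i|%:R.
Proof.
have := dR_gt2 => d2; rewrite /log_size /speed /cutoff_const; field.
by rewrite !gt_eqF ?ln_gt0 //; lra.
Qed.

(** The threshold N depends neither on the graph nor on the starting point,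
    so that any choice of starting points is covered. *)
Lemma Tmix_window (alpha eps : R) : 0 < alpha < 1 -> 0 < eps < 1 ->
  exists N : nat, forall i (x0 : G i), (N < #|G i|)%N ->
    0 < ln (#|G i|%:R : R) /\
    (1 - eps) * (cutoff_const * ln #|G i|%:R) <= (Tmix d x0 alpha)%:R
      <= (1 + eps) * (cutoff_const * ln #|G i|%:R).
Proof.
move=> alpha01 eps01.
have [L1 before] := not_mixed_before d_gt2 alpha01 eps01.
have [delta [L2 [delta0 after]]] := mixed_soon_after d_gt2 alpha01 eps01.
have [N1 rho_near] := ramanujan delta0.
have b0 : 0 < ln (d%:R - 1 : R) by rewrite ln_gt0 //; have := dR_gt2; lra.
pose x := expR (ln (d%:R - 1) * Num.max L1 L2) : R.
exists (maxn 1 (maxn N1 (Num.truncn x).+1)) => i x0.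
rewrite !gtn_max => /and3P[n1 nN1 nx].
have n0 : 0 < #|G i|%:R :> R by rewrite ltr0n ltnW.
have L_large : Num.max L1 L2 <= log_size R d (G i).
  rewrite ler_pdivlMr // mulrC -ler_expR lnK ?posrE // -/x.
  apply: ltW; apply: lt_le_trans (truncnS_gt _) _.
  by rewrite ler_nat ltnW.
move: L_large; rewrite ge_max => /andP[L1le L2le].
split; first by rewrite ln_gt0 // ltr1n.
have winE c : c * (cutoff_const * ln #|G i|%:R) =
    c * log_size R d (G i) / speed R d by rewrite -log_size_speed mulrA.
rewrite !winE; apply: Tmix_bounds => [t|].
  exact: before.
by apply: after => //; exact: rho_near.
Qed.

Lemma Tmix_asymptotics (alpha : R) (X : forall i, G i) : 0 < alpha < 1 ->
  size_lim G (fun i => (Tmix d (X i) alpha)%:R / ln #|G i|%:R) cutoff_const.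
Proof.
move=> alpha01 eta eta0; have c0 := cutoff_const_gt0.
pose eps := Num.min 2^-1 (eta / (2 * cutoff_const)).
have eps01 : 0 < eps < 1.
  apply/andP; split; last by rewrite gt_min invf_lt1 // ltr1n.
  rewrite lt_min invr_gt0 ltr0n /=; apply: divr_gt0 => //; exact: mulr_gt0.
have eps_c : eps * cutoff_const < eta.
  have : eps <= eta / (2 * cutoff_const) by rewrite ge_min lexx orbT.
  rewrite ler_pdivlMr; last exact: mulr_gt0.
  by rewrite mulrCA; lra.
have [N window] := Tmix_window alpha01 eps01.
exists N => i /window - /(_ (X i)) [ln0 /andP[lo hi]].
rewrite ltr_norml ltrBrDr ltrBlDr ltr_pdivlMr // ltr_pdivrMr //.
have := ltr_pM2r ln0 (eps * cutoff_const) eta; rewrite eps_c.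
by move=> h; apply/andP; split; lra.
Qed.

Lemma cutoff : exhibits_cutoff R G d.
Proof.
move=> alpha alpha' X alpha01 alpha'01 eta eta0; have c0 := cutoff_const_gt0.
pose eps := Num.min 2^-1 (eta / 8).
have eps01 : 0 < eps < 1.
  by rewrite lt_min gt_min invr_gt0 ltr0n divr_gt0 //= invf_lt1 // ltr1n.
have eps2 : eps <= 2^-1 by rewrite ge_min lexx.
have eps8 : eps <= eta / 8 by rewrite ge_min lexx orbT.
have [N1 window1] := Tmix_window alpha01 eps01.
have [N2 window2] := Tmix_window alpha'01 eps01.
exists (maxn N1 N2) => i; rewrite gtn_max => /andP[nN1 nN2].
have [ln0 /andP[lo1 hi1]] := window1 i (X i) nN1.
have [_ /andP[lo2 hi2]] := window2 i (X i) nN2.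
set a := cutoff_const * _ in lo1 hi1 lo2 hi2.
have a0 : 0 < a by exact: mulr_gt0.
move: ((Tmix d (X i) alpha)%:R : R) ((Tmix d (X i) alpha')%:R : R) lo1 hi1 lo2 hi2.
move=> T1 T2 lo1 hi1 lo2 hi2.
have ea : eps * a <= 2^-1 * a by rewrite ler_pM2r.
have ea8 : eps * a <= eta / 8 * a by rewrite ler_pM2r.
have T2a : 2^-1 * a <= T2 by lra.
have T2_gt0 : 0 < T2 by lra.
have etaT : eta * (2^-1 * a) <= eta * T2 by rewrite ler_pM2l.
have etaa : 0 < eta * a by exact: mulr_gt0.
rewrite ltr_norml ltrBrDr ltrBlDr ltr_pdivlMr // ltr_pdivrMr //.
by apply/andP; split; lra.
Qed.

End Family.

Theorem theorem1 (R : realType) (d : nat) (I : Type) (G : I -> sgraph)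
    (hd : (3 <= d)%N)
    (hG : forall i, [/\ connected (G i), regular d (G i) & ~ bipartite (G i)])
    (hR : asymptotically_Ramanujan R G d) :
  exhibits_cutoff R G d /\
  (forall (alpha : R) (X : forall i, G i), 0 < alpha < 1 ->
     size_lim G (fun i => (Tmix d (X i) alpha)%:R / ln (#|G i|%:R : R))
       (d%:R / ((d%:R - 2) * ln (d%:R - 1)))).
Proof.
have regG i : regular d (G i) by case: (hG i).
by split=> [|alpha X]; [exact: cutoff | exact: Tmix_asymptotics].
Qed.
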